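(* There exist large enough absolute constants $c,c_1$ such that the following holds. Let $P:\{0,1\}^k\to\{0,1\}$ be a $t$-resilient $k$-ary predicate, let $0<\epsilon<1-3\frac{\log 24}{\log n}$ and $k<n/c$. Suppose an algorithm (read-once branching program) distinguishes between $D_{null}$ and $D_{planted}(x)$, for $x$ uniform on $\{0,1\}^n$, with success probability at least $\frac12+s$ and uses fewer than $n^{\epsilon}$ bits of memory. Then, whenever $0<t\le k<n^{\frac{1-\epsilon}{6}}/3$ and $s>c_1\left(\frac nt\right)^{-\frac{1-\epsilon}{36}t}$, the algorithm requires $\left(\frac nt\right)^{\frac{1-\epsilon}{36}t}$ samples.
   Context: Logarithms are base 2. $[n]^{(k)}$ is the set of ordered $k$-tuples of distinct elements of $[n]=\{1,\dots,n\}$; for $a\in[n]^{(k)}$, $a^i$ is its $i$-th entry, and for $x\in\{0,1\}^n$, $x^a\in\{0,1\}^k$ is given by $(x^a)^i=x^{a^i}$. Writing $(-1)^{P(y)}=\sum_{\alpha\subseteq[k]}\hat P(\alpha)\chi_\alpha(y)$ with $\chi_\alpha(y)=(-1)^{\sum_{i\in\alpha}y^i}$, $P$ is $t$-resilient if $t$ is the maximum positive integer such that $\hat P(\alpha)=0$ whenever $|\alpha|<t$. $D_{null}$: $a$ uniform in $[n]^{(k)}$ and $b$ an independent uniform bit; $D_{planted}(x)$: $a$ uniform in $[n]^{(k)}$ and $b=P(x^a)$. A distinguisher is a branching program: a layered directed multigraph with $m+1$ layers of at most $d$ vertices, a single start vertex in layer 0, each non-leaf vertex having one outgoing edge to the next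 layer for each sample value $(a,b)\in[n]^{(k)}\times\{0,1\}$, leaves labeled by outputs ``null'' (0) or ``planted'' (1); memory $b$ means width $2^b$ and the number of samples is the length $m$. Its success probability is $$\frac{\Pr_{u_1,\dots,u_m\sim D_{null}}[L=\text{null}]+\Pr_{x\in_R\{0,1\}^n;\,u_1,\dots,u_m\sim D_{planted}(x)}[L=\text{planted}]}{2},$$ samples drawn independently. *)

(* Defs.v *)
From HB Require Import structures.
From mathcomp Require Import all_boot all_order all_algebra.
From mathcomp Require Import reals exp.

Set Implicit Arguments.
Unset Strict Implicit.
Unset Printing Implicit Defensive.

Import Order.TTheory GRing.Theory Num.Theory.
Local Open Scope ring_scope.

Definition log2 (R : realType) (x : R) : R := ln x / ln 2.

Definition cube (n : nat) := {ffun 'I_n -> bool}.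

Definition chi (R : realType) (k : nat) (alpha : {set 'I_k}) (y : cube k) : R :=
  (-1) ^+ (\sum_(i in alpha) y i)%N.

(* The coefficient of chi alpha in the expansion of (-1)^P; the expansion
   itself is [fourier_expansion] below. *)
Definition fourier (R : realType) (k : nat) (P : cube k -> bool)
    (alpha : {set 'I_k}) : R :=
  (2 ^+ k)^-1 * \sum_(y : cube k) (-1) ^+ P y * chi R alpha y.

Definition vanishes_below (R : realType) (k : nat) (P : cube k -> bool)
    (t : nat) : Prop :=
  forall alpha : {set 'I_k}, (#|alpha| < t)%N -> fourier R P alpha = 0.

Definition resilient (R : realType) (k : nat) (P : cube k -> bool)
    (t : nat) : Prop :=
  [/\ (0 < t)%N, vanishes_below R P t &
      forall t' : nat, (0 < t')%N -> vanishes_below R P t' -> (t' <= t)%N].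

Definition ktuples (n k : nat) := {a : {ffun 'I_k -> 'I_n} | injectiveb a}.

Definition restr (n k : nat) (x : cube n) (a : ktuples n k) : cube k :=
  [ffun i => x (val a i)].

Definition sample (n k : nat) := (ktuples n k * bool)%type.

(* Distributions on a finite type are given by their mass functions. *)
Definition D_null (R : realType) (n k : nat) (u : sample n k) : R :=
  #|{: ktuples n k}|%:R^-1 * 2^-1.

Definition D_planted (R : realType) (n k : nat) (P : cube k -> bool)
    (x : cube n) (u : sample n k) : R :=
  #|{: ktuples n k}|%:R^-1 * (u.2 == P (restr x u.1))%:R.

Definition Pr_iid (R : realType) (X : finType) (D : X -> R) (m : nat)
    (E : pred (m.-tuple X)) : R :=
  \sum_(u : m.-tuple X | E u) \prod_(i < m) D (tnth u i).

(* A vertex is either a leaf carrying its output ([inl], with [false] for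
   "null" and [true] for "planted"), or has one outgoing edge for every sample
   value ([inr]). Leaves may occur before the last layer. *)
Record branching_program (X : finType) (m : nat) := BranchingProgram {
  bp_vertex : finType;
  bp_layer : bp_vertex -> 'I_m.+1;
  bp_start : bp_vertex;
  bp_node : bp_vertex -> bool + (X -> bp_vertex);
  bp_startP : forall v, (bp_layer v == 0 :> nat) = (v == bp_start);
  bp_edgeP : forall v f x, bp_node v = inr f ->
    bp_layer (f x) = (bp_layer v).+1 :> nat;
  bp_lastP : forall v, bp_layer v = m :> nat ->
    exists o : bool, bp_node v = inl o
}.

Definition bp_width (X : finType) (m : nat) (B : branching_program X m) : nat :=
  \max_(j < m.+1) #|[set v | bp_layer (b := B) v == j]|.

Definition bp_memory (R : realType) (X : finType) (m : nat)
    (B : branching_program X m) : R := log2 (bp_width B)%:R.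

Fixpoint bp_walk (X : finType) (m : nat) (B : branching_program X m)
    (v : bp_vertex B) (s : seq X) : bp_vertex B :=
  match s with
  | [::] => v
  | x :: s' => match bp_node v with
               | inl _ => v
               | inr f => bp_walk (f x) s'
               end
  end.

(* [None] does not occur on m samples: see [bp_outputP]. *)
Definition bp_output (X : finType) (m : nat) (B : branching_program X m)
    (s : seq X) : option bool :=
  match bp_node (bp_walk (bp_start B) s) with
  | inl o => Some o
  | inr _ => None
  end.

Definition success (R : realType) (n k : nat) (P : cube k -> bool) (m : nat)
    (B : branching_program (sample n k) m) : R :=
  (Pr_iid (@D_null R n k) (fun u : m.-tuple _ => bp_output B u == Some false)
   + (2 ^+ n)^-1 * \sum_(x : cube n)
       Pr_iid (D_planted R P x)
         (fun u : m.-tuple _ => bp_output B u == Some true)) / 2.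

Lemma chi_orth (R : realType) (k : nat) (y z : cube k) :
  \sum_(alpha : {set 'I_k}) chi R alpha y * chi R alpha z
  = 2 ^+ k * (y == z)%:R.
Proof.
pose F i (b : bool) : R := if b then (-1) ^+ (y i + z i)%N else 1.
transitivity (\prod_(i < k) \sum_(b : bool) F i b).
  rewrite bigA_distr_bigA /= (reindex (fun f : {ffun 'I_k -> bool} =>
    [set i | f i])) /=.
    apply: eq_bigr => f _.
    rewrite /chi -exprD -big_split /= expr_sum big_mkcond /=.
    by apply: eq_bigr => i _; rewrite inE /F; case: (f i).
  exists (fun A : {set 'I_k} => [ffun i => i \in A]) => [f _|A _].
    by apply/ffunP => i; rewrite ffunE inE.
  by apply/setP => i; rewrite inE ffunE.
case: eqP => [yz|nyz].
  rewrite mulr1 (eq_bigr (fun=> 2)); first by rewrite big_const_ord iter_mulr_1.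
  by move=> i _; rewrite big_bool /F /= yz addnn -mul2n exprM sqrrN !expr1n.
rewrite mulr0; have [i nyzi] : exists i, y i != z i.
  apply/existsP; apply: contra_notT nyz => /existsPn h.
  by apply/ffunP => i; apply/eqP/negPn/h.
rewrite (bigD1 i) //= big_bool /F.
by case: (y i) (z i) nyzi => [] [] // _; rewrite /= ?expr1 addNr mul0r.
Qed.

Lemma fourier_expansion (R : realType) (k : nat) (P : cube k -> bool)
    (y : cube k) :
  (-1) ^+ P y = \sum_(alpha : {set 'I_k}) fourier R P alpha * chi R alpha y.
Proof.
under eq_bigr do rewrite /fourier -mulrA mulr_suml.
rewrite -mulr_sumr exchange_big /=.
under eq_bigr do (under eq_bigr do rewrite -mulrA; rewrite -mulr_sumr chi_orth).
rewrite (bigD1 y) //= eqxx mulr1 big1 ?addr0; last first.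
  by move=> z /negPf ->; rewrite !mulr0.
by rewrite mulrCA mulVf ?mulr1 // expf_neq0 // pnatr_eq0.
Qed.

Lemma bp_outputP (X : finType) (m : nat) (B : branching_program X m)
    (u : m.-tuple X) : exists o : bool, bp_output B u = Some o.
Proof.
suff H (s : seq X) (v : bp_vertex B) : (bp_layer v + size s = m)%N ->
    exists o, bp_node (bp_walk v s) = inl o.
  have /eqP h0 : bp_layer (bp_start B) == 0 :> nat by rewrite bp_startP.
  have [|o ho] := H u (bp_start B); first by rewrite h0 size_tuple.
  by exists o; rewrite /bp_output ho.
elim: s v => [|x s IH] v /=; first by rewrite addn0; exact: bp_lastP.
case E: (bp_node v) => [o|f] hv; first by exists o.
by apply: IH; rewrite (bp_edgeP x E) addSnnS.
Qed.

(* Main.v *)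
(** Write the two experiments as the endpoints of a hybrid: in the [j]-th hybrid
    the first [j] samples are planted for a common secret [x] and the others are
    null.  Two consecutive hybrids differ only in one sample [(a, b)], and the
    samples after it do not depend on [x]; so, if [phi v x] is the probability of
    reaching the vertex [v] of layer [j] on planted samples, the difference is at
    most half of the sum over [v] of the average over [a] of
    [|E_x phi v x * (-1) ^ P (x^a)|].

    By Cauchy-Schwarz and resilience, the square of that expectation is at most
    the Fourier weight of [phi v] on the sets of size at least [t] covered by
    [a].  A random [a] covers [S] with probability at most [(k/n)^|S|], and
    hypercontractivity with exponent [2p] bounds
    [sum_S (2p-1)^-|S| * phi^(S)^2] by [(E phi)^(2-1/p)].  Taking [p] just above
    [n^eps], which exceeds the memory, makes the sum over the vertices of the
    layer harmless, and the advantage is at most [m * (k(2p-1)/n)^(t/2)]. *)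
Require Import Defs.
From mathcomp Require Import all_boot all_order all_algebra.
From mathcomp Require Import fingroup perm.
From mathcomp Require Import reals exp.
From mathcomp Require Import ring lra zify.

Set Implicit Arguments.
Unset Strict Implicit.
Unset Printing Implicit Defensive.

Import Order.TTheory GRing.Theory Num.Theory.
Local Open Scope ring_scope.

(** * Inequalities between means *)

(** AM-GM for [a] copies of [u] and [j] copies of [v]. *)
Lemma weighted_AGM (R : numFieldType) (u v : R) (a j : nat) :
  0 <= u -> 0 <= v ->
  u ^+ a * v ^+ j <= ((u *+ a + v *+ j) / (a + j)%:R) ^+ (a + j).
Proof.
move=> u0 v0.
pose E (i : 'I_(a + j)) := if split i is inl _ then u else v.
have El i : E (lshift j i) = u by rewrite /E (unsplitK (inl i)).
have Er i : E (rshift a i) = v by rewrite /E (unsplitK (inr i)).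
have E0 : {in 'I_(a + j), forall i, 0 <= E i}.
  by move=> i _; rewrite /E; case: split.
have := leif_AGM E0; rewrite card_ord => -[+ _].
rewrite !big_split_ord /= (eq_bigr (fun=> u)) => [|i _]; last exact: El.
rewrite [X in _ * X](eq_bigr (fun=> v)) => [|i _]; last exact: Er.
rewrite [X in (X + _) / _](eq_bigr (fun=> u)) => [|i _]; last exact: El.
rewrite [X in (_ + X) / _](eq_bigr (fun=> v)) => [|i _]; last exact: Er.
by rewrite !sumr_const !prodr_const !card_ord.
Qed.

(** Young's inequality in integer powers: raised to the power [a + j], it is [weighted_AGM] for
    [u ^+ (a + j)] and [v ^+ (a + j)]. *)
Lemma young_nat (R : numFieldType) (u v : R) (a j : nat) :
  0 <= u -> 0 <= v ->
  u ^+ a * v ^+ j *+ (a + j) <= u ^+ (a + j) *+ a + v ^+ (a + j) *+ j.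
Proof.
move=> u0 v0; have [->|q0] := posnP (a + j)%N.
  by rewrite mulr0n addr_ge0 // mulrn_wge0 // exprn_ge0.
rewrite -mulr_natr -ler_pdivlMr ?ltr0n //.
rewrite -(@ler_pXn2r _ (a + j)%N) ?nnegrE ?divr_ge0 ?addr_ge0 ?mulr_ge0
  ?mulrn_wge0 ?exprn_ge0 //.
rewrite exprMn -!exprM ![(_ * (a + j))%N]mulnC !exprM.
by apply: weighted_AGM; apply: exprn_ge0.
Qed.

(** Tangent-line proof: Young's inequality is summed for [g i] against the weighted mean of [g]. The
    weights need not add up to 1, hence the factor [(\sum_i w i) ^+ a]. *)
Lemma jensen_pow (R : numFieldType) (I : finType) (w g : I -> R) (a : nat) :
  (forall i, 0 <= w i) -> (forall i, 0 <= g i) ->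
  (\sum_i w i * g i) ^+ a.+1 <= (\sum_i w i) ^+ a * \sum_i w i * g i ^+ a.+1.
Proof.
move=> w0 g0; set M := \sum_i w i; set G := \sum_i w i * g i.
have M0 : 0 <= M by apply: sumr_ge0.
have G0 : 0 <= G by apply: sumr_ge0 => i _; apply: mulr_ge0.
have [Mz|Mn0] := eqVneq M 0.
  have wz i : w i = 0 by apply: (psumr_eq0P (P := predT) (fun i _ => w0 i) Mz).
  have -> : G = 0 by apply: big1 => i _; rewrite wz mul0r.
  rewrite expr0n mulr_ge0 ?exprn_ge0 ?sumr_ge0 // => i _.
  by rewrite mulr_ge0 ?exprn_ge0.
have Mp : 0 < M by rewrite lt_def Mn0.
pose x := G / M; have x0 : 0 <= x by apply: divr_ge0.
have GE : G = x * M by rewrite /x mulfVK.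
have : \sum_i w i * (x ^+ a * g i *+ a.+1)
       <= \sum_i w i * (x ^+ a.+1 *+ a + g i ^+ a.+1).
  apply: ler_sum => i _; apply: ler_wpM2l => //.
  by have := young_nat a 1 x0 (g0 i); rewrite addn1 expr1 mulr1n.
have -> : \sum_i w i * (x ^+ a * g i *+ a.+1) = x ^+ a.+1 * M *+ a.+1.
  have -> : x ^+ a.+1 * M *+ a.+1 = x ^+ a * G *+ a.+1.
    by rewrite GE exprSr mulrA.
  rewrite /G mulr_sumr -sumrMnl; apply: eq_bigr => i _.
  by rewrite mulrnAr mulrCA.
have -> : \sum_i w i * (x ^+ a.+1 *+ a + g i ^+ a.+1)
    = x ^+ a.+1 * M *+ a + \sum_i w i * g i ^+ a.+1.
  rewrite (eq_bigr _ (fun i _ => mulrDr _ _ _)) big_split /=; congr (_ + _).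
  by rewrite -mulr_suml -/M mulrC mulrnAl.
rewrite mulrSr lerD2l => h.
rewrite GE exprMn [M ^+ a.+1]exprS mulrA mulrC.
by apply: ler_wpM2l => //; apply: exprn_ge0.
Qed.

(** [A] and [B] stand for bounds on the norms of exponent [a + j], so no roots appear. Normalise by
    them, apply Young pointwise and sum; zero exponents and zero bounds are treated apart. *)
Lemma holder_pow (R : numFieldType) (I : finType) (w u v : I -> R) (A B : R)
    (a j : nat) :
  (forall i, 0 <= w i) -> (forall i, 0 <= u i) -> (forall i, 0 <= v i) ->
  0 <= A -> 0 <= B ->
  \sum_i w i * u i ^+ (a + j) <= A ^+ (a + j) ->
  \sum_i w i * v i ^+ (a + j) <= B ^+ (a + j) ->
  \sum_i w i * (u i ^+ a * v i ^+ j) <= A ^+ a * B ^+ j.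
Proof.
have vanish (f : I -> R) (C : R) b q : (forall i, 0 <= w i) ->
    (forall i, 0 <= f i) -> (0 < b <= q)%N -> C = 0 ->
    \sum_i w i * f i ^+ q <= C ^+ q -> forall i, w i * f i ^+ b = 0.
  move=> w0 f0 /andP[b0 bq] -> + i; rewrite expr0n gtn_eqF ?(leq_trans b0 bq) //.
  move=> h; have F0 i' : true -> 0 <= w i' * f i' ^+ q.
    by move=> _; rewrite mulr_ge0 // exprn_ge0.
  have sz : \sum_i w i * f i ^+ q = 0.
    by apply/eqP; rewrite eq_le h sumr_ge0.
  have /eqP := psumr_eq0P F0 sz (i := i) isT.
  rewrite mulf_eq0 expf_eq0 => /orP[/eqP->|/andP[_ /eqP ->]].
    by rewrite mul0r.
  by rewrite expr0n gtn_eqF // mulr0.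
move=> w0 u0 v0 A0 B0 hu hv.
case: (posnP a) hu hv => [-> _|ap hu].
  by rewrite add0n expr0 mul1r => hv; under eq_bigr do rewrite expr0 mul1r.
case: (posnP j) hu => [->|jp hu hv].
  by rewrite addn0 !expr0 mulr1 => hu _; under eq_bigr do rewrite expr0 mulr1.
have q0 : (0 < a + j)%N by rewrite addn_gt0 ap.
have [Az|An0] := eqVneq A 0.
  rewrite big1 ?mulr_ge0 ?exprn_ge0 // => i _.
  by rewrite mulrA (vanish u A a (a + j)%N) ?mul0r // ap leq_addr.
have [Bz|Bn0] := eqVneq B 0.
  rewrite big1 ?mulr_ge0 ?exprn_ge0 // => i _.
  by rewrite mulrCA (vanish v B j (a + j)%N) ?mulr0 // jp leq_addl.
have Ap : 0 < A by rewrite lt_def An0.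
have Bp : 0 < B by rewrite lt_def Bn0.
pose c := A ^+ a * B ^+ j.
have c0 : 0 <= c by rewrite mulr_ge0 // exprn_ge0.
rewrite -(@ler_pMn2r _ (a + j)%N) // -sumrMnl.
have -> : A ^+ a * B ^+ j *+ (a + j) = c *+ a + c *+ j by rewrite mulrnDr.
apply: (@le_trans _ _ (\sum_i (c * (A ^- (a + j) * (w i * u i ^+ (a + j)) *+ a
   + B ^- (a + j) * (w i * v i ^+ (a + j)) *+ j)))).
  apply: ler_sum => i _.
  have := young_nat a j (divr_ge0 (u0 i) A0) (divr_ge0 (v0 i) B0).
  move/(ler_wpM2l (mulr_ge0 c0 (w0 i))); congr (_ <= _).
    rewrite !mulrnAr !expr_div_n; congr (_ *+ _).
    rewrite /c; have := expf_neq0 a An0; have := expf_neq0 j Bn0.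
    by move: (A ^+ a) (B ^+ j) => x y y0 x0; field; rewrite x0 y0.
  rewrite !expr_div_n.
  by move: (A ^+ _)^-1 (B ^+ _)^-1 (u i ^+ _) (v i ^+ _) => x y z t; ring.
rewrite -mulr_sumr big_split /= !sumrMnl -!mulr_sumr.
rewrite mulrDr !mulrnAr; apply: lerD; rewrite lerMn2r; apply/orP; right.
  by rewrite ger_pMr ?mulr_gt0 ?exprn_gt0 // mulrC ler_pdivrMr ?exprn_gt0 // mul1r.
by rewrite ger_pMr ?mulr_gt0 ?exprn_gt0 // mulrC ler_pdivrMr ?exprn_gt0 // mul1r.
Qed.

(** Lagrange's identity: the gap is half of a double sum of squares. *)
Lemma cauchy_schwarz (R : realDomainType) (I : finType) (a b : I -> R) :
  (\sum_i a i * b i) ^+ 2 <= (\sum_i a i ^+ 2) * (\sum_i b i ^+ 2).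
Proof.
have : 0 <= \sum_i \sum_j (a i * b j - a j * b i) ^+ 2.
  by apply: sumr_ge0 => i _; apply: sumr_ge0 => j _; apply: sqr_ge0.
have -> : \sum_i \sum_j (a i * b j - a j * b i) ^+ 2 =
   \sum_i \sum_j a i ^+ 2 * b j ^+ 2 + \sum_i \sum_j a j ^+ 2 * b i ^+ 2
   - (\sum_i \sum_j (a i * b i) * (a j * b j)) *+ 2.
  rewrite -big_split -sumrMnl -sumrB; apply: eq_bigr => i _.
  rewrite -big_split -sumrMnl -sumrB; apply: eq_bigr => j _ /=; ring.
rewrite [X in _ + X - _]exchange_big /= -mulr2n -mulrnBl pmulrn_lge0 // subr_ge0.
rewrite expr2 !mulr_suml; under eq_bigr do rewrite -mulr_sumr.
by congr (_ <= _); apply: eq_bigr => i _; rewrite mulr_sumr.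
Qed.

(** From [j] to [j + 1] the growth factors of the two binomials have quotient
    [(2p - 2j - 1) / (2j + 1)], at most [2p - 1]. This is the source of the constant in
    hypercontractivity. *)
Lemma bin_double_le (p j : nat) :
  ('C(p.*2, j.*2) <= (p.*2.-1) ^ j * 'C(p, j))%N.
Proof.
elim: j => [|j IH]; first by rewrite !bin0.
have [pj|jp] := leqP p j.
  by rewrite bin_small // doubleS ltnW // !ltnS leq_double.
have e1 := mul_bin_left p.*2 j.*2; have e2 := mul_bin_left p.*2 j.*2.+1.
have e3 := mul_bin_left p j.
rewrite -(leq_pmul2l (isT : 0 < j.*2.+2)%N) -(leq_pmul2l (isT : 0 < j.*2.+1)%N).
rewrite doubleS e2 mulnCA e1 expnS.
have -> : (j.*2.+1 * (j.*2.+2 * (p.*2.-1 * p.*2.-1 ^ j * 'C(p, j.+1))))%N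
  = ((j.*2.+1 * p.*2.-1) * ((p - j).*2 * (p.*2.-1 ^ j * 'C(p, j))))%N.
  by rewrite -doubleS -[j.+1.*2]mul2n -[(p-j).*2]mul2n -[(2 * (p - j) * _)%N]mulnA
   [((p - j) * (_ * _))%N]mulnCA -e3; ring.
rewrite doubleB; apply: leq_mul; last by rewrite leq_mul2l IH orbT.
apply: (@leq_trans (p.*2.-1)); last by rewrite leq_pmull.
by rewrite subnS -!subn1 leq_sub2r // leq_subr.
Qed.

(** * Hypercontractivity on the cube *)

Lemma big_ord_even_odd (V : nmodType) (F : nat -> V) (p : nat) :
  \sum_(i < p.*2.+1) F i
  = \sum_(j < p.+1) F j.*2 + \sum_(j < p) F j.*2.+1.
Proof.
elim: p => [|p IH]; first by rewrite !big_ord_recr !big_ord0 /= addr0.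
rewrite doubleS 2!big_ord_recr /= IH [in RHS]big_ord_recr /=.
by rewrite [\sum_(j < p.+1) F j.*2.+1]big_ord_recr /= addrACA -!addrA;
  congr (_ + (_ + _)); rewrite addrC.
Qed.

(** Odd powers cancel between the two signs, and [bin_double_le] compares the even ones. The right
    side is [(f ^+ 2 + sg * h ^+ 2) ^+ p], left expanded because Hölder is later applied term by
    term. *)
Lemma two_point_le (R : realFieldType) (sg f h : R) (p : nat) :
  0 <= sg -> sg * (p.*2.-1)%:R <= 1 ->
  ((f + sg * h) ^+ p.*2 + (f - sg * h) ^+ p.*2) / 2
  <= \sum_(j < p.+1) (f ^+ 2) ^+ (p - j) * (sg * h ^+ 2) ^+ j *+ 'C(p, j).
Proof.
move=> sg0 sgp.
rewrite !exprDn -big_split /= (big_ord_even_odd (fun i =>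
  f ^+ (p.*2 - i) * (sg * h) ^+ i *+ 'C(p.*2, i)
  + f ^+ (p.*2 - i) * (- (sg * h)) ^+ i *+ 'C(p.*2, i))).
rewrite [X in _ + X]big1 => [|j _]; last first.
  rewrite [(- _) ^+ _]exprNn -signr_odd /= odd_double expr1 mulN1r mulrN.
  by rewrite mulNrn subrr.
rewrite addr0 mulr_suml; apply: ler_sum => -[j /= jp] _.
rewrite [(- _) ^+ _]exprNn -signr_odd odd_double mul1r -mulr2n.
rewrite -[X in X / _]mulr_natr mulfK ?pnatr_eq0 //.
rewrite -doubleB -!mul2n !exprM -mulrnAr -[leRHS]mulrnAr.
apply: ler_wpM2l; first by rewrite exprn_ge0 // sqr_ge0.
rewrite [(sg * h) ^+ 2]exprMn [(sg ^+ 2 * _) ^+ j]exprMn [(sg * h ^+ 2) ^+ j]exprMn.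
rewrite -[leLHS]mulrnAl -[leRHS]mulrnAl; apply: ler_wpM2r; first by rewrite exprn_ge0 // sqr_ge0.
rewrite -[leLHS]mulr_natr -[leRHS]mulr_natr expr2 exprMn -mulrA.
apply: ler_wpM2l; first exact: exprn_ge0.
apply: (@le_trans _ _ (sg ^+ j * ((p.*2.-1) ^ j * 'C(p, j))%:R)).
  by rewrite ler_wpM2l ?exprn_ge0 // ler_nat !mul2n bin_double_le.
rewrite natrM natrX mulrA -exprMn ler_piMl // exprn_ile1 //.
by rewrite mulr_ge0.
Qed.

Lemma chi_prod (R : realType) (n : nat) (S : {set 'I_n}) (x : cube n) :
  chi R S x = \prod_(i in S) (-1) ^+ x i.
Proof. by rewrite /chi expr_sum. Qed.

Lemma chi_setU1 (R : realType) (n : nat) (i : 'I_n) (S : {set 'I_n})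
    (x : cube n) : i \notin S ->
  chi R (i |: S) x = (-1) ^+ x i * chi R S x.
Proof. by move=> iS; rewrite !chi_prod big_setU1. Qed.

Definition flip (n : nat) (i : 'I_n) (x : cube n) : cube n :=
  [ffun j => x j (+) (j == i)].

Lemma flipK (n : nat) (i : 'I_n) : involutive (flip i).
Proof. by move=> x; apply/ffunP => j; rewrite !ffunE addbK. Qed.

Lemma chi_flip (R : realType) (n : nat) (i : 'I_n) (S : {set 'I_n})
    (x : cube n) : i \notin S -> chi R S (flip i x) = chi R S x.
Proof.
move=> iS; rewrite !chi_prod; apply: eq_bigr => j jS.
rewrite ffunE; case: eqP => [ji|_]; last by rewrite addbF.
by rewrite ji (negPf iS) in jS.
Qed.

(** The noise operator of rate [sg] on the function with Fourier coefficients [c], cut down to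
    subsets of [D] so that coordinates can be added one by one. *)
Definition noisy (R : realType) (n : nat) (sg : R) (D : {set 'I_n})
    (c : {set 'I_n} -> R) (x : cube n) : R :=
  \sum_(S : {set 'I_n} | S \subset D) sg ^+ #|S| * c S * chi R S x.

Lemma big_subset_setU1 (V : nmodType) (T : finType) (i : T) (D : {set T})
    (F : {set T} -> V) : i \notin D ->
  \sum_(S : {set T} | S \subset i |: D) F S
  = \sum_(S : {set T} | S \subset D) (F S + F (i |: S)).
Proof.
move=> iD; rewrite big_split (bigID (fun S : {set T} => i \notin S)) /=.
congr (_ + _).
  by apply: eq_bigl => S; rewrite -subsetD1 setU1K.
rewrite (reindex_onto (fun S => i |: S) (fun S => S :\ i)); last first.
  by move=> S /andP[_]; rewrite negbK => iS; rewrite setD1K.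
apply: eq_bigl => S; rewrite negbK setU11 andbT subUset sub1set setU11 /=.
have [iS|iS] := boolP (i \in S).
  rewrite (_ : (_ == S) = false) ?andbF; last first.
    by apply/eqP => h; have := setD11 i (i |: S); rewrite h iS.
  by apply/esym/negP => /subsetP/(_ i iS); rewrite (negPf iD).
rewrite setU1K // eqxx andbT; apply/idP/idP => [|h].
  by move=> h; rewrite -(setU1K iD) subsetD1 h.
exact: subset_trans h (subsetUr _ _).
Qed.

(* With [c S = sg ^- (|S|/2) * g^(S)] this is [||T_rho g||_2p <= ||g||_2] for
   [rho^2 = sg]; the weights are placed so that no square root appears. *)
Lemma hypercontractive (R : realType) (n p : nat) (sg : R) (D : {set 'I_n})
    (c : {set 'I_n} -> R) :
  0 <= sg -> sg * (p.*2.-1)%:R <= 1 ->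
  \sum_(x : cube n) (2 ^+ n)^-1 * noisy sg D c x ^+ p.*2
  <= (\sum_(S : {set 'I_n} | S \subset D) sg ^+ #|S| * c S ^+ 2) ^+ p.
Proof.
move=> sg0 sgp; move: {2}#|D| (erefl #|D|) c => d.
elim: d D => [|d IH] D Dd c.
  have -> : D = set0 by apply: cards0_eq.
  have e F : \sum_(S : {set 'I_n} | S \subset set0) F S = F set0 :> R.
    by rewrite (big_pred1 set0) // => S; rewrite subset0.
  rewrite e cards0 mul1r -exprM mul2n.
  rewrite (eq_bigr (fun=> (2 ^+ n)^-1 * c set0 ^+ p.*2)) => [|x _].
    rewrite sumr_const card_ffun card_bool card_ord -[leLHS]mulr_natl natrX mulrA.
    by rewrite mulfV ?mul1r // expf_neq0 // pnatr_eq0.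
  by rewrite /noisy e cards0 mul1r chi_prod big_set0 mulr1.
have [i iD] : exists i, i \in D by apply/card_gt0P; rewrite Dd.
have -> : D = i |: (D :\ i) by rewrite setD1K.
have iD' : i \notin D :\ i by rewrite setD11.
have : #|D :\ i| = d by move: Dd; rewrite (cardsD1 i D) iD => -[].
move: (D :\ i) iD' => {iD Dd}D iD Dd.
pose c' S := c (i |: S).
pose N b := \sum_(S : {set 'I_n} | S \subset D) sg ^+ #|S| * b S ^+ 2.
have N0 b : 0 <= N b.
  by apply: sumr_ge0 => S _; rewrite mulr_ge0 ?sqr_ge0 ?exprn_ge0.
have nS (S : {set 'I_n}) : S \subset D -> i \notin S.
  by move=> SD; apply: contra iD; apply: (subsetP SD).
have -> : \sum_(S : {set 'I_n} | S \subset i |: D) sg ^+ #|S| * c S ^+ 2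
    = N c + sg * N c'.
  rewrite big_subset_setU1 // big_split /= mulr_sumr; congr (_ + _).
  by apply: eq_bigr => S /nS iS; rewrite cardsU1 iS add1n exprS mulrA.
(* Neither noisy sum over [D] depends on [x i], so coordinate [i] enters only through its sign. *)
have split_noisy x : noisy sg (i |: D) c x =
    noisy sg D c x + sg * ((-1) ^+ x i * noisy sg D c' x).
  rewrite /noisy big_subset_setU1 // big_split /= !mulr_sumr; congr (_ + _).
  apply: eq_bigr => S /nS iS; rewrite cardsU1 iS add1n exprS chi_setU1 //.
  by rewrite /c'; ring.
have noisy_flip b x : noisy sg D b (flip i x) = noisy sg D b x.
  by apply: eq_bigr => S /nS iS; rewrite chi_flip.
pose w := (2 ^+ n)^-1 : R; have w0 : 0 <= w by rewrite invr_ge0 exprn_ge0.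
pose f := noisy sg D c; pose h := noisy sg D c'.
(* Averaging over the pair [x], [flip i x] produces the left side of [two_point_le]. *)
have -> : \sum_(x : cube n) w * noisy sg (i |: D) c x ^+ p.*2
  = \sum_(x : cube n) w * (((f x + sg * ((-1) ^+ x i * h x)) ^+ p.*2
      + (f x - sg * ((-1) ^+ x i * h x)) ^+ p.*2) / 2).
  apply: (@mulIf _ 2); first by rewrite pnatr_eq0.
  rewrite mulr_natr mulr2n {2}(reindex_inj (inv_inj (@flipK n i))) /=.
  rewrite -big_split mulr_suml; apply: eq_bigr => x _ /=.
  rewrite !split_noisy !noisy_flip -/f -/h ffunE eqxx addbT.
  rewrite (_ : (-1) ^+ (~~ x i) = - (-1) ^+ x i); last first.
    by case: (x i); rewrite ?expr0 ?expr1 ?opprK.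
  rewrite mulNr mulrN -mulrDr -[RHS]mulrA mulfVK //.
  by rewrite pnatr_eq0.
apply: (@le_trans _ _ (\sum_(j < p.+1) N c ^+ (p - j) * (sg * N c') ^+ j
    *+ 'C(p, j))); last by rewrite exprDn.
apply: (@le_trans _ _ (\sum_(x : cube n) w * \sum_(j < p.+1)
    (f x ^+ 2) ^+ (p - j) * (sg * h x ^+ 2) ^+ j *+ 'C(p, j))).
  apply: ler_sum => x _; apply: ler_wpM2l => //.
  have -> : h x ^+ 2 = ((-1) ^+ x i * h x) ^+ 2 by rewrite exprMn sqrr_sign mul1r.
  exact: two_point_le.
under eq_bigr do rewrite mulr_sumr.
rewrite exchange_big /=; apply: ler_sum => -[j /= jp] _.
under eq_bigr do rewrite mulrnAr [(sg * _) ^+ j]exprMn.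
rewrite sumrMnl lerMn2r; apply/orP; right.
under eq_bigr do rewrite [_ * (sg ^+ j * _)]mulrCA [w * _]mulrCA.
rewrite -mulr_sumr [(sg * _) ^+ j]exprMn [leRHS]mulrCA; apply: ler_wpM2l; first exact: exprn_ge0.
have pj : (p - j + j)%N = p by rewrite subnK.
(* Hölder splits the mixed moment of [f ^+ 2] and [h ^+ 2] into [p]-th moments, which the induction
   hypothesis bounds. *)
apply: holder_pow => //; try (by move=> x; rewrite sqr_ge0); try exact: N0.
- rewrite pj; under eq_bigr do rewrite -exprM mul2n.
  exact: IH.
- rewrite pj; under eq_bigr do rewrite -exprM mul2n.
  exact: IH.
Qed.

(** * Bias of the predicate on a random tuple *)

Definition fcoef (R : realType) (n : nat) (phi : cube n -> R)
    (S : {set 'I_n}) : R :=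
  \sum_(x : cube n) (2 ^+ n)^-1 * phi x * chi R S x.

(** The sum [W] on the left is the inner product of [phi] with its noisy version. By Jensen,
    [W ^+ (2p)] is at most [mu ^+ (2p - 1)] times the [2p]-th moment of the latter, which
    hypercontractivity bounds by [W ^+ p]; a factor [W ^+ p] cancels. *)
Lemma small_set_noise (R : realType) (n p : nat) (sg : R) (phi : cube n -> R) :
  (0 < p)%N -> 0 <= sg -> sg * (p.*2.-1)%:R <= 1 ->
  (forall x, 0 <= phi x <= 1) ->
  (\sum_(S : {set 'I_n}) sg ^+ #|S| * fcoef phi S ^+ 2) ^+ p
  <= (\sum_(x : cube n) (2 ^+ n)^-1 * phi x) ^+ p.*2.-1.
Proof.
move=> p0 sg0 sgp phi01; set W := \sum_S _; set mu := \sum_x _.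
pose w := (2 ^+ n)^-1 : R; have w0 : 0 <= w by rewrite invr_ge0 exprn_ge0.
have wphi0 x : 0 <= w * phi x by rewrite mulr_ge0 //; case/andP: (phi01 x).
have mu0 : 0 <= mu by apply: sumr_ge0.
have W0 : 0 <= W.
  by apply: sumr_ge0 => S _; rewrite mulr_ge0 ?sqr_ge0 ?exprn_ge0.
pose G := noisy sg [set: 'I_n] (fcoef phi).
have WE : W = \sum_x w * phi x * G x.
  rewrite /W /G /noisy.
  under [RHS]eq_bigr do rewrite mulr_sumr.
  rewrite exchange_big /= [RHS](eq_bigl predT) => [|S]; last by rewrite /= subsetT.
  apply: eq_bigr => S _; rewrite expr2 mulrA {2}/fcoef mulr_sumr.
  by apply: eq_bigr => x _; rewrite -/w; ring.
have p2 : p.*2 = p.*2.-1.+1 by rewrite prednK // double_gt0.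
have hG : \sum_x w * G x ^+ p.*2 <= W ^+ p.
  have := hypercontractive [set: 'I_n] (fcoef phi) sg0 sgp.
  by rewrite [X in _ <= X ^+ p -> _](eq_bigl predT) // => S; rewrite /= subsetT.
have h : W ^+ p * W ^+ p <= mu ^+ p.*2.-1 * W ^+ p.
  rewrite -exprD addnn; apply: (@le_trans _ _ ((\sum_x w * phi x * `|G x|) ^+ p.*2)).
    rewrite lerXn2r ?nnegrE //; first by apply: sumr_ge0 => x _; rewrite mulr_ge0.
    by rewrite WE; apply: ler_sum => x _; rewrite ler_wpM2l // ler_norm.
  rewrite {1}p2; apply: (le_trans (jensen_pow _ _ _)) => //.
  apply: ler_wpM2l; first exact: exprn_ge0.
  rewrite -p2; apply: le_trans hG; apply: ler_sum => x _.
  rewrite -normrX ger0_norm; last by rewrite -mul2n exprM exprn_ge0 // sqr_ge0.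
  apply: ler_wpM2r; first by rewrite -mul2n exprM exprn_ge0 // sqr_ge0.
  by apply: ler_piMr => //; case/andP: (phi01 x).
have [->|Wn0] := eqVneq W 0; first by rewrite expr0n gtn_eqF ?exprn_ge0.
by move: h; rewrite ler_pM2r // exprn_gt0 // lt_def Wn0.
Qed.

(** * Tuples covering a given set *)

Definition tuple_set (n k : nat) (a : ktuples n k) : {set 'I_n} :=
  val a @: [set: 'I_k].

Lemma ktuple_inj (n k : nat) (a : ktuples n k) : injective (val a).
Proof. exact/injectiveP/(valP a). Qed.

Lemma card_tuple_set (n k : nat) (a : ktuples n k) : #|tuple_set a| = k.
Proof. by rewrite card_imset ?cardsT ?card_ord //; exact: ktuple_inj. Qed.

Lemma perm_ktuple_subproof (n k : nat) (s : {perm 'I_n}) (a : ktuples n k) :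
  injectiveb [ffun i => s (val a i)].
Proof.
apply/injectiveP => i j; rewrite !ffunE => /perm_inj; exact: ktuple_inj.
Qed.

Definition perm_ktuple (n k : nat) (s : {perm 'I_n}) (a : ktuples n k) :
  ktuples n k := Sub [ffun i => s (val a i)] (perm_ktuple_subproof s a).

Lemma perm_ktupleK (n k : nat) (s : {perm 'I_n}) :
  cancel (@perm_ktuple n k s) (perm_ktuple s^-1).
Proof.
by move=> a; apply: val_inj; apply/ffunP => i; rewrite !ffunE permK.
Qed.

Lemma tuple_set_perm (n k : nat) (s : {perm 'I_n}) (a : ktuples n k) :
  tuple_set (perm_ktuple s a) = s @: tuple_set a.
Proof.
by rewrite /tuple_set -imset_comp; apply: eq_imset => i /=; rewrite ffunE.
Qed.

Definition ncover (n k : nat) (S : {set 'I_n}) : nat :=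
  #|[set a : ktuples n k | S \subset tuple_set a]|.

Lemma ncover_perm (n k : nat) (s : {perm 'I_n}) (S : {set 'I_n}) :
  ncover k (s @: S) = ncover k S.
Proof.
rewrite /ncover -[RHS](card_imset _ (can_inj (@perm_ktupleK n k s))).
apply: eq_card => a; rewrite !inE; apply/idP/imsetP => [h|[b + ->]].
  exists (perm_ktuple s^-1 a).
    rewrite inE tuple_set_perm; have := imsetS s^-1%g h.
    rewrite -imset_comp (eq_imset (g := id)) ?imset_id // => x /=.
    by rewrite permK.
  by have := perm_ktupleK s^-1%g a; rewrite invgK.
by rewrite inE tuple_set_perm => h; apply: imsetS.
Qed.

(* All points outside [S] are equivalent under permutations, which determines
   the fraction of the tuples covering [S] that also cover [i]. *)
Lemma ncover_setU1 (n k : nat) (S : {set 'I_n}) (i : 'I_n) : i \notin S ->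
  (n * ncover k (i |: S) <= k * ncover k S)%N.
Proof.
move=> iS; have [->|] := posnP (ncover k (i |: S)); first by rewrite muln0.
move/card_gt0P => [a _].
have kn : (k <= n)%N.
  by have := max_card (mem (tuple_set a)); rewrite card_tuple_set card_ord.
have ln : (#|S| < n)%N.
  have := max_card (mem (i |: S)).
  by rewrite cardsU1 iS card_ord.
have sym j : j \notin S -> ncover k (j |: S) = ncover k (i |: S).
  move=> jS; rewrite -(ncover_perm k (tperm i j) (i |: S)); congr ncover.
  rewrite imsetU1 tpermL; congr (_ |: _).
  rewrite -[LHS]imset_id; apply: eq_in_imset => x xS.
  by rewrite tpermD //; [apply: contraNneq iS | apply: contraNneq jS] => ->.
(* Double counting of pairs of a point [j] outside [S] and a tuple covering [j |: S]. *)
have e : ((n - #|S|) * ncover k (i |: S) = (k - #|S|) * ncover k S)%N.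
  transitivity (\sum_(j in ~: S) ncover k (j |: S))%N.
    rewrite (eq_bigr (fun=> ncover k (i |: S))) => [|j]; last by rewrite inE; exact: sym.
    by rewrite sum_nat_const (cardsCs (~: S)) setCK card_ord.
  rewrite /ncover; under eq_bigr do rewrite -sum1_card.
  rewrite (exchange_big_dep [pred a : ktuples n k | S \subset tuple_set a]) /=; last first.
    by move=> j b _; rewrite inE; apply: subset_trans; exact: subsetUr.
  rewrite mulnC -sum_nat_const /=.
  apply: eq_big => [b|b Sb]; first by rewrite inE.
  have <- : #|tuple_set b :\: S| = (k - #|S|)%N.
    by rewrite cardsD (setIidPr Sb) card_tuple_set.
  by rewrite -sum1_card; apply: eq_bigl => j; rewrite !inE subUset sub1set Sb andbT.
rewrite -(@leq_pmul2l (n - #|S|)) ?subn_gt0 // mulnCA e !mulnA leq_mul2r.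
by rewrite mulnBr mulnBl leq_sub2l ?orbT // mulnC leq_mul2r kn orbT.
Qed.

Lemma ncover_le (n k : nat) (S : {set 'I_n}) :
  (n ^ #|S| * ncover k S <= k ^ #|S| * #|{: ktuples n k}|)%N.
Proof.
move: {2}#|S| (erefl #|S|) => l; elim: l S => [|l IH] S Sl.
  by rewrite Sl !expn0 !mul1n max_card.
have [i iS] : exists i, i \in S by apply/card_gt0P; rewrite Sl.
have Dl : #|S :\ i| = l by move: Sl; rewrite (cardsD1 i S) iS => -[].
have := @ncover_setU1 n k (S :\ i) i; rewrite setD11 setD1K // => /(_ isT) h.
have := IH _ Dl; rewrite Dl Sl => h'.
rewrite !expnSr -!mulnA; apply: leq_trans (_ : n ^ l * (k * ncover k (S :\ i)) <= _)%N.
  by rewrite leq_mul2l h orbT.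
by rewrite mulnCA [leqRHS]mulnCA leq_mul2l h' orbT.
Qed.

(** * Fourier expansion of the bias *)

Lemma chi_restr (R : realType) (n k : nat) (al : {set 'I_k}) (x : cube n)
    (a : ktuples n k) : chi R al (restr x a) = chi R (val a @: al) x.
Proof.
rewrite !chi_prod big_imset /=; last by move=> i j _ _; exact: ktuple_inj.
by apply: eq_bigr => i _; rewrite ffunE.
Qed.

Lemma parseval_sign (R : realType) (k : nat) (P : cube k -> bool) :
  \sum_(al : {set 'I_k}) fourier R P al ^+ 2 = 1.
Proof.
under eq_bigr do rewrite expr2 {2}/fourier mulrCA mulr_sumr.
rewrite -mulr_sumr exchange_big /=.
rewrite (eq_bigr (fun=> 1)) => [|y _].
  rewrite sumr_const card_ffun card_bool card_ord natrX mulVf //.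
  by rewrite expf_neq0 // pnatr_eq0.
under eq_bigr do rewrite mulrCA.
by rewrite -mulr_sumr -fourier_expansion -expr2 sqrr_sign.
Qed.

Definition bias (R : realType) (n k : nat) (P : cube k -> bool)
    (phi : cube n -> R) (a : ktuples n k) : R :=
  \sum_(x : cube n) (2 ^+ n)^-1 * phi x * (-1) ^+ P (restr x a).

Lemma bias_fourier (R : realType) (n k : nat) (P : cube k -> bool)
    (phi : cube n -> R) (a : ktuples n k) :
  bias P phi a = \sum_(al : {set 'I_k}) fourier R P al * fcoef phi (val a @: al).
Proof.
rewrite /bias; under eq_bigr do rewrite fourier_expansion mulr_sumr.
rewrite exchange_big /=; apply: eq_bigr => al _.
rewrite mulr_sumr; apply: eq_bigr => x _; rewrite chi_restr; ring.
Qed.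

(** Restriction to [a] turns the character of [al] into that of its image. The small [al] drop out;
    Cauchy-Schwarz against the coefficients of [P], of total weight 1, leaves the weight of [phi] on
    the images, which are the subsets of [tuple_set a]. *)
Lemma bias_sqr_le (R : realType) (n k t : nat) (P : cube k -> bool)
    (phi : cube n -> R) (a : ktuples n k) :
  vanishes_below R P t ->
  bias P phi a ^+ 2
  <= \sum_(S : {set 'I_n} | (t <= #|S|)%N && (S \subset tuple_set a))
       fcoef phi S ^+ 2.
Proof.
move=> Pt; pose b (al : {set 'I_k}) := if (t <= #|al|)%N then fcoef phi (val a @: al) else 0.
have -> : bias P phi a = \sum_al fourier R P al * b al.
  rewrite bias_fourier; apply: eq_bigr => al _; rewrite /b.
  by case: leqP => // /Pt ->; rewrite !mul0r.
apply: (le_trans (cauchy_schwarz _ _)).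
rewrite parseval_sign mul1r.
rewrite (reindex_onto (fun al : {set 'I_k} => val a @: al)
  (fun S : {set 'I_n} => val a @^-1: S)) /=; last first.
  move=> S /andP[_ /subsetP Sa]; apply/setP => j; apply/imsetP/idP => [[i + ->]|jS].
    by rewrite inE.
  have /imsetP[i _ ji] := Sa _ jS; exists i => //.
  by rewrite inE -ji.
rewrite [leRHS](eq_bigl (fun al : {set 'I_k} => t <= #|al|)%N) => [|al]; last first.
  rewrite card_imset; last exact: ktuple_inj.
  rewrite imsetS ?subsetT // andbT (_ : _ == al) ?andbT //.
  apply/eqP/setP => i; rewrite inE mem_imset //; exact: ktuple_inj.
rewrite [leRHS]big_mkcond /=; apply: ler_sum => al _; rewrite /b.
by case: ifP => // _; rewrite expr0n.
Qed.

(** Exchanging the sums weighs each [S] by the fraction of tuples covering it, at most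
    [(k / n) ^+ #|S|]. With [r = k / n / sg] this is [r ^+ #|S| * sg ^+ #|S|], and [r <= 1] with
    [t <= #|S|] leaves [r ^+ t]. *)
Lemma sum_bias_le (R : realType) (n k t : nat) (P : cube k -> bool)
    (phi : cube n -> R) (sg : R) :
  vanishes_below R P t -> (0 < n)%N -> 0 < sg -> k%:R / n%:R / sg <= 1 ->
  \sum_(a : ktuples n k) bias P phi a ^+ 2
  <= #|{: ktuples n k}|%:R * ((k%:R / n%:R / sg) ^+ t *
     \sum_(S : {set 'I_n}) sg ^+ #|S| * fcoef phi S ^+ 2).
Proof.
move=> Pt n0 sg0 r1; set r := _ / sg; set K := _%:R.
have r0 : 0 <= r by rewrite !divr_ge0 // ltW.
have K0 : 0 <= K by rewrite /K ler0n.
apply: (@le_trans _ _ (\sum_(S : {set 'I_n} | (t <= #|S|)%N)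
    (ncover k S)%:R * fcoef phi S ^+ 2)).
  apply: (le_trans (ler_sum _ (fun a _ => bias_sqr_le phi a Pt))).
  rewrite (exchange_big_dep (fun S : {set 'I_n} => t <= #|S|)%N) /=; last first.
    by move=> a S _ /andP[].
  apply: ler_sum => S tS; rewrite tS /= sumr_const mulr_natl /ncover.
  by rewrite (eq_card (B := [set a : ktuples n k | S \subset tuple_set a])) // => a; rewrite inE.
rewrite !mulr_sumr big_mkcond /=; apply: ler_sum => S _.
have F0 : 0 <= fcoef phi S ^+ 2 by rewrite sqr_ge0.
case: ifP => tS; last first.
  apply: (mulr_ge0 K0); apply: (mulr_ge0 (exprn_ge0 _ r0)).
  exact: (mulr_ge0 (exprn_ge0 _ (ltW sg0))).
move: (fcoef phi S ^+ 2) F0 => F F0; rewrite !mulrA ler_wpM2r //.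
apply: (@le_trans _ _ (K * (k%:R / n%:R) ^+ #|S|)).
  rewrite expr_div_n mulrA ler_pdivlMr ?exprn_gt0 ?ltr0n //.
  by rewrite /K -!natrX -!natrM ler_nat mulnC [leqRHS]mulnC ncover_le.
rewrite -mulrA ler_wpM2l // (_ : k%:R / n%:R = r * sg); last first.
  by rewrite /r mulfVK // gt_eqF.
rewrite exprMn ler_wpM2r ?(exprn_ge0 _ (ltW sg0)) //.
exact: (ler_wiXn2l r0 r1 tS).
Qed.

Lemma sum_norm_bias_le (R : realType) (n k t p : nat) (P : cube k -> bool)
    (phi : cube n -> R) (T : R) :
  vanishes_below R P t -> (0 < n)%N -> (0 < p)%N -> 0 <= T ->
  T ^+ 2 = (k%:R * p.*2.-1%:R / n%:R) ^+ t ->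
  k%:R * p.*2.-1%:R / n%:R <= 1 :> R ->
  (forall x, 0 <= phi x <= 1) ->
  (#|{: ktuples n k}|%:R^-1 * \sum_(a : ktuples n k) `|bias P phi a|) ^+ p.*2
  <= T ^+ p.*2 * (\sum_(x : cube n) (2 ^+ n)^-1 * phi x) ^+ p.*2.-1.
Proof.
move=> Pt n0 p0 T0 TE r1 phi01; set K := _%:R; set mu := \sum_(x : cube n) _.
pose q := p.*2.-1; have q0 : (0 < q)%N by rewrite /q; lia.
(* The largest rate that hypercontractivity with exponent [2p] allows. *)
pose sg := (q%:R)^-1 : R; have sg0 : 0 < sg by rewrite invr_gt0 ltr0n.
have rE : k%:R / n%:R / sg = k%:R * q%:R / n%:R :> R by rewrite /sg invrK mulrAC.
pose W := \sum_(S : {set 'I_n}) sg ^+ #|S| * fcoef phi S ^+ 2.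
have hW : W ^+ p <= mu ^+ q.
  apply: (small_set_noise p0 (ltW sg0)) => //.
  by rewrite /sg mulVf // pnatr_eq0 -lt0n.
have K0 : 0 <= K by rewrite /K ler0n.
(* Cauchy-Schwarz over the tuples passes from the mean of absolute values to the mean square. *)
have h : (K^-1 * \sum_a `|bias P phi a|) ^+ 2 <= T ^+ 2 * W.
  have W0 : 0 <= W.
    by apply: sumr_ge0 => S _; rewrite mulr_ge0 ?sqr_ge0 ?exprn_ge0 ?ltW.
  have [Kz|Kn0] := eqVneq K 0.
    by rewrite Kz invr0 mul0r expr0n mulr_ge0 // sqr_ge0.
  have Kp : 0 < K by rewrite lt_def Kn0.
  rewrite exprMn exprVn mulrC ler_pdivrMr ?exprn_gt0 //.
  have := cauchy_schwarz (fun=> 1) (fun a : ktuples n k => `|bias P phi a|).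
  under eq_bigr do rewrite mul1r; move/le_trans; apply.
  under eq_bigr do rewrite expr1n.
  rewrite sumr_const [_ *+ _](_ : _ = K); last by rewrite /K; congr (_ *+ _); apply: eq_card.
  rewrite expr2 mulrA [leRHS]mulrC ler_wpM2l // mulrC.
  under eq_bigr do rewrite real_normK ?num_real //.
  have := @sum_bias_le R n k t P phi sg Pt n0 sg0; rewrite rE => /(_ r1).
  by rewrite -TE.
rewrite -mul2n !exprM; apply: (@le_trans _ _ ((T ^+ 2 * W) ^+ p)).
  rewrite lerXn2r ?nnegrE ?sqr_ge0 //; exact: le_trans (sqr_ge0 _) h.
by rewrite exprMn -exprM mul2n -/q ler_wpM2l ?exprn_ge0 // sqr_ge0.
Qed.

(* Here [y i <= T * mu i ^ (1 - 1/2p)]; by concavity, [4^p] such terms add up to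
   at most [(4^p)^(1/2p) = 2] times [T]. *)
Lemma sum_le_of_pow (R : realType) (I : finType) (A : {set I}) (p : nat)
    (T : R) (y mu : I -> R) :
  (0 < p)%N -> 0 <= T -> (#|A| <= 4 ^ p)%N ->
  (forall i, 0 <= y i) -> (forall i, 0 <= mu i) -> \sum_(i in A) mu i <= 1 ->
  (forall i, y i ^+ p.*2 <= T ^+ p.*2 * mu i ^+ p.*2.-1) ->
  \sum_(i in A) y i <= 2 * T.
Proof.
move=> p0 T0 Ap y0 mu0 mu1 ymu; set q := p.*2.-1 in ymu *.
have q2 : p.*2 = (q + 1)%N by rewrite /q; lia.
pose e := (4 ^+ p)^-1 : R; have e0 : 0 <= e by rewrite invr_ge0 exprn_ge0.
have N0 : 0 < (p.*2)%:R :> R by rewrite ltr0n double_gt0.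
(* AM-GM for [q] copies of [mu i] and one of [e = 4 ^- p]. *)
have hy i : y i <= 2 * T * ((mu i *+ q + e) / (p.*2)%:R).
  have b0 : 0 <= 2 * T * ((mu i *+ q + e) / (p.*2)%:R).
    by apply: mulr_ge0; [apply: mulr_ge0 | apply: divr_ge0; rewrite ?addr_ge0 ?mulrn_wge0].
  rewrite -(@ler_pXn2r _ p.*2) ?nnegrE ?double_gt0 //.
  apply: (le_trans (ymu i)); have := weighted_AGM q 1 (mu0 i) e0.
  rewrite -q2 expr1 mulr1n => h; rewrite [leRHS]exprMn.
  apply: le_trans (ler_wpM2l (exprn_ge0 p.*2 (mulr_ge0 (ler0n R 2) T0)) h).
  rewrite exprMn.
  have -> : 2 ^+ p.*2 = 4 ^+ p :> R by rewrite -mul2n exprM -natrX.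
  rewrite mulrACA [4 ^+ p * _]mulrC /e.
  rewrite (_ : _ * _ * _ = T ^+ p.*2 * mu i ^+ q * (4 ^+ p / 4 ^+ p)); last by ring.
  by rewrite divff ?mulr1 // expf_neq0 // pnatr_eq0.
(* Over [A] the [mu] terms add up to at most [q] and the [e] terms to at most [4 ^ p * e = 1], in
   total [2p]. *)
apply: (le_trans (ler_sum _ (fun i _ => hy i))).
rewrite -mulr_sumr ler_piMr ?mulr_ge0 // -mulr_suml ler_pdivrMr // mul1r.
rewrite big_split /= sumr_const sumrMnl q2 natrD lerD //.
  by rewrite -[leLHS]mulr_natr ler_piMl.
rewrite -[leLHS]mulr_natr /e mulrC ler_pdivrMr ?exprn_gt0 // mul1r.
by rewrite -natrX ler_nat.
Qed.

(** * Hybrids along a branching program *)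

Section BranchingProgram.
Variables (R : realType) (X : finType) (m : nat) (B : branching_program X m).
Implicit Types (v : bp_vertex B) (D : X -> R).

(* Leaves absorb the walk, so that every walk has the same number of steps. *)
Definition bp_step v (x : X) : bp_vertex B :=
  if bp_node v is inr f then f x else v.

Definition leaf_output v : option bool :=
  if bp_node v is inl o then Some o else None.

Lemma bp_walk_leaf v (s : seq X) o : bp_node v = inl o -> bp_walk v s = v.
Proof. by case: s => [|x s] //= ->. Qed.

Lemma bp_walk_cons v (x : X) (s : seq X) :
  bp_walk v (x :: s) = bp_walk (bp_step v x) s.
Proof.
by rewrite /= /bp_step; case E: (bp_node v) => [o|f] //; rewrite (bp_walk_leaf s E).
Qed.

(** Recursion on the first remaining sample, so that a hybrid step unfolds by computation. *)
Fixpoint pr_output D (o : bool) (r : nat) v : R :=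
  if r is r'.+1 then \sum_(x : X) D x * pr_output D o r' (bp_step v x)
  else (leaf_output v == Some o)%:R.

Lemma sum_tuple_cons (r : nat) (F : r.+1.-tuple X -> R) :
  \sum_(u : r.+1.-tuple X) F u
  = \sum_(x : X) \sum_(u : r.-tuple X) F (cons_tuple x u).
Proof.
rewrite pair_bigA /= (reindex (fun q : X * r.-tuple X => cons_tuple q.1 q.2)) //.
exists (fun u => (thead u, behead_tuple u)) => [[x u] _|u _] /=.
  by congr pair; apply: val_inj.
by rewrite [RHS]tuple_eta; apply: val_inj.
Qed.

Lemma pr_outputE D (o : bool) (r : nat) v :
  Pr_iid D (fun u : r.-tuple X => leaf_output (bp_walk v u) == Some o)
  = pr_output D o r v.
Proof.
rewrite /Pr_iid big_mkcond /=; elim: r v => [|r IH] v.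
  rewrite (big_pred1 [tuple]) => [|u]; last by rewrite [u]tuple0; apply/esym/eqP.
  by rewrite /= big_ord0; case: eqP.
rewrite sum_tuple_cons /=; apply: eq_bigr => x _.
rewrite -IH mulr_sumr; apply: eq_bigr => u _.
rewrite -bp_walk_cons; case: ifP => _; last by rewrite mulr0.
rewrite big_ord_recl (tnth_nth x) /=; congr (_ * _); apply: eq_bigr => i _.
by rewrite !(tnth_nth x).
Qed.

(** Forward recursion on the last sample, dual to [pr_output]. Leaves keep the mass they absorb, so
    a leaf may be occupied at a time [j] later than its layer. *)
Fixpoint pr_reach D (j : nat) v : R :=
  if j is j'.+1 then
    \sum_v' pr_reach D j' v' * \sum_(x : X) D x * (bp_step v' x == v)%:R
  else (v == bp_start B)%:R.

(** A forward step on the mass is adjoint to a backward step on the test function [g]; this moves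
    samples between [pr_reach] and [pr_output]. *)
Lemma pr_reach_step D (j : nat) (g : bp_vertex B -> R) :
  \sum_v pr_reach D j.+1 v * g v
  = \sum_v pr_reach D j v * \sum_(x : X) D x * g (bp_step v x).
Proof.
under eq_bigr do rewrite mulr_suml.
rewrite exchange_big /=; apply: eq_bigr => v _.
under eq_bigr do rewrite -mulrA mulr_suml.
rewrite -mulr_sumr exchange_big /=; congr (_ * _); apply: eq_bigr => x _.
rewrite (bigD1 (bp_step v x)) //= eqxx mulr1 big1 ?addr0 // => w.
by rewrite eq_sym => /negPf ->; rewrite mulr0 mul0r.
Qed.

Lemma pr_reach_output D (o : bool) (j r : nat) :
  \sum_v pr_reach D j v * pr_output D o r v
  = pr_output D o (j + r) (bp_start B).
Proof.
elim: j r => [|j IH] r; last by rewrite pr_reach_step addSnnS -IH.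
rewrite (bigD1 (bp_start B)) //= eqxx mul1r big1 ?addr0 // => v /negPf ->.
by rewrite mul0r.
Qed.

Lemma pr_reach_ge0 D (j : nat) v : (forall x, 0 <= D x) -> 0 <= pr_reach D j v.
Proof.
move=> D0; elim: j v => [|j IH] v /=; first by rewrite ler0n.
apply: sumr_ge0 => v' _; apply: mulr_ge0 => //.
by apply: sumr_ge0 => x _; apply: mulr_ge0.
Qed.

Lemma sum_pr_reach_le1 D (j : nat) :
  (forall x, 0 <= D x) -> \sum_x D x <= 1 -> \sum_v pr_reach D j v <= 1.
Proof.
move=> D0 D1; elim: j => [|j IH].
  rewrite /= (bigD1 (bp_start B)) //= eqxx big1 ?addr0 // => v /negPf ->.
  by [].
under eq_bigr do rewrite -[pr_reach _ _ _]mulr1.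
rewrite (pr_reach_step D j (fun=> 1)); apply: le_trans IH; apply: ler_sum => v _.
under eq_bigr do rewrite mulr1.
by rewrite ler_piMr // pr_reach_ge0.
Qed.

Lemma pr_reach_le1 D (j : nat) v :
  (forall x, 0 <= D x) -> \sum_x D x <= 1 -> pr_reach D j v <= 1.
Proof.
move=> D0 D1; apply: le_trans (sum_pr_reach_le1 j D0 D1).
by rewrite (bigD1 v) //= lerDl; apply: sumr_ge0 => w _; apply: pr_reach_ge0.
Qed.

Lemma pr_output_ge0 D o (r : nat) v :
  (forall x, 0 <= D x) -> 0 <= pr_output D o r v.
Proof.
move=> D0; elim: r v => [|r IH] v /=; first by rewrite ler0n.
by apply: sumr_ge0 => x _; apply: mulr_ge0.
Qed.

Lemma pr_output_total D (r : nat) v :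
  (forall x, 0 <= D x) -> \sum_x D x <= 1 ->
  pr_output D false r v + pr_output D true r v <= 1.
Proof.
move=> D0 D1; elim: r v => [|r IH] v /=.
  by case: (leaf_output v) => [[]|]; rewrite /= ?addr0 ?add0r ?ler01.
rewrite -big_split /=; apply: le_trans D1; apply: ler_sum => x _.
by rewrite -mulrDr ler_piMr.
Qed.

(** A walk standing at a non-leaf has descended one layer with each sample; at a leaf it may have
    been waiting. *)
Lemma pr_reach_layer D (j : nat) v f :
  bp_node v = inr f -> pr_reach D j v != 0 -> bp_layer v = j :> nat.
Proof.
elim: j v f => [|j IH] v f vf /=.
  have [-> _|] := eqVneq v; last by rewrite eqxx.
  by apply/eqP; rewrite bp_startP.
move=> nz; have [v' hv'] : exists v', pr_reach D j v' *
    (\sum_(x : X) D x * (bp_step v' x == v)%:R) != 0.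
  apply/existsP; apply: contraNT nz => /existsPn h.
  by rewrite big1 // => v' _; apply/eqP/negPn/h.
move: hv'; rewrite mulf_eq0 negb_or => /andP[r0 s0].
have [x /eqP hx] : exists x, bp_step v' x == v.
  apply/existsP; apply: contraNT s0 => /existsPn h.
  by rewrite big1 // => x _; rewrite (negPf (h x)) mulr0.
move: hx; rewrite /bp_step; case E: (bp_node v') => [o|g] hx.
  by rewrite -hx E in vf.
by rewrite -hx (bp_edgeP x E) (IH _ _ E r0).
Qed.

Lemma hybrid D D' (o : bool) :
  pr_output D' o m (bp_start B) - pr_output D o m (bp_start B)
  = \sum_(j < m) \sum_v pr_reach D' j v *
      \sum_(x : X) (D' x - D x) * pr_output D o (m - j.+1) (bp_step v x).
Proof.
(* [H j] takes [j] samples from [D'] and then [m - j] from [D]; the differences telescope. *)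
pose H j := \sum_v pr_reach D' j v * pr_output D o (m - j) v.
have -> : pr_output D o m (bp_start B) = H 0.
  rewrite /H subn0 (bigD1 (bp_start B)) //= eqxx mul1r big1 ?addr0 // => v.
  by move=> /negPf ->; rewrite mul0r.
have -> : pr_output D' o m (bp_start B) = H m.
  by rewrite -{1}[m]addn0 -pr_reach_output /H subnn.
rewrite -(telescope_sumr H (leq0n m)) big_mkord; apply: eq_bigr => j _.
rewrite /H pr_reach_step -sumrB; apply: eq_bigr => v _.
rewrite -mulrBr; congr (_ * _).
rewrite -(subnSK (ltn_ord j)) /= -sumrB.
by apply: eq_bigr => x _; rewrite mulrBl.
Qed.

End BranchingProgram.

(** * Advantage and success probability of a program *)

Lemma sum_cube_weight (R : realType) (n : nat) :
  \sum_(x : cube n) (2 ^+ n)^-1 = 1 :> R.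
Proof.
rewrite sumr_const card_ffun card_bool card_ord -[LHS]mulr_natl natrX.
by rewrite mulfV // expf_neq0 // pnatr_eq0.
Qed.

Section Advantage.
Variables (R : realType) (n k : nat) (P : cube k -> bool).
Let K : R := #|{: ktuples n k}|%:R.

Lemma sum_sample (F : sample n k -> R) :
  \sum_u F u = \sum_(a : ktuples n k) (F (a, true) + F (a, false)).
Proof.
rewrite (eq_bigr (fun u => F (u.1, u.2))) => [|[] //].
rewrite -(pair_bigA _ (fun a b => F (a, b))) /=.
by apply: eq_bigr => a _; rewrite big_bool.
Qed.

Lemma D_null_ge0 (u : sample n k) : 0 <= D_null R u.
Proof. by rewrite /D_null mulr_ge0 ?invr_ge0. Qed.

Lemma D_planted_ge0 (x : cube n) (u : sample n k) : 0 <= D_planted R P x u.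
Proof. by rewrite /D_planted mulr_ge0 ?invr_ge0. Qed.

Lemma sum_D_null : \sum_u @D_null R n k u = K / K.
Proof.
rewrite sum_sample (eq_bigr (fun=> K^-1)) => [|a _].
  by rewrite sumr_const -[LHS]mulr_natl; congr (_%:R * _); apply: eq_card.
rewrite /D_null -/K; lra.
Qed.

Lemma sum_D_planted (x : cube n) : \sum_u D_planted R P x u = K / K.
Proof.
rewrite sum_sample (eq_bigr (fun=> K^-1)) => [|a _].
  by rewrite sumr_const -[LHS]mulr_natl; congr (_%:R * _); apply: eq_card.
by rewrite /D_planted -/K /=; case: (P _); rewrite /= ?mulr1 ?mulr0 ?addr0 ?add0r.
Qed.

(** Without any [k]-tuple [K] is zero and the quotient defaults to 0, so total masses are only
    bounded by 1. *)
Lemma divff_le1 : K / K <= 1.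
Proof. by have [->|h] := eqVneq K 0; rewrite ?mul0r ?ler01 ?divff. Qed.

(** For fixed [a], summing planted minus null over the bit gives [(-1) ^+ P (restr x a)] times half
    of [g (a, false) - g (a, true)], divided by [K]. As [g] is free of [x], averaging over [x]
    yields the bias. *)
Lemma step_bias_le (phi : cube n -> R) (g : sample n k -> R) :
  (forall u, 0 <= g u <= 1) ->
  \sum_(x : cube n) (2 ^+ n)^-1 * (phi x *
     \sum_u (D_planted R P x u - D_null R u) * g u)
  <= K^-1 * (\sum_(a : ktuples n k) `|bias P phi a|) / 2.
Proof.
move=> g01.
have -> : \sum_(x : cube n) (2 ^+ n)^-1 * (phi x *
     \sum_u (D_planted R P x u - D_null R u) * g u)
   = \sum_(a : ktuples n k) K^-1 * ((g (a, false) - g (a, true)) / 2 * bias P phi a).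
  under eq_bigr do rewrite sum_sample !mulr_sumr.
  rewrite exchange_big /=; apply: eq_bigr => a _.
  rewrite /bias !mulr_sumr; apply: eq_bigr => x _.
  rewrite /D_planted /D_null -/K /=.
  by move: (K^-1) ((2 ^+ n)^-1) => z w; case: (P _); rewrite /= ?expr0 ?expr1; field.
rewrite -mulrA mulr_suml mulr_sumr; apply: ler_sum => a _.
rewrite ler_wpM2l ?invr_ge0 //; apply: le_trans (ler_norm _) _.
rewrite normrM mulrC ler_wpM2l //.
by have /andP[? ?] := g01 (a, false); have /andP[? ?] := g01 (a, true);
  rewrite ler_norml; apply/andP; split; lra.
Qed.

Lemma advantage_le (m p t : nat) (B : branching_program (sample n k) m) (T : R) :
  vanishes_below R P t -> (0 < n)%N -> (0 < p)%N -> 0 <= T ->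
  T ^+ 2 = (k%:R * p.*2.-1%:R / n%:R) ^+ t ->
  k%:R * p.*2.-1%:R / n%:R <= 1 :> R ->
  (bp_width B <= 4 ^ p)%N ->
  \sum_(x : cube n) (2 ^+ n)^-1 * (pr_output (D_planted R P x) true m (bp_start B)
     - pr_output (@D_null R n k) true m (bp_start B)) <= m%:R * T.
Proof.
move=> Pt n0 p0 T0 TE r1 wB.
under eq_bigr do rewrite hybrid mulr_sumr.
rewrite exchange_big /=.
have -> : m%:R * T = \sum_(j < m) T by rewrite sumr_const card_ord mulr_natl.
apply: ler_sum => j _.
under eq_bigr do rewrite mulr_sumr.
rewrite exchange_big /=.
pose phi (v : bp_vertex B) (x : cube n) := pr_reach (D_planted R P x) j v : R.
have D1 (x : cube n) : \sum_u D_planted R P x u <= 1 by rewrite sum_D_planted divff_le1.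
have phi01 v x : 0 <= phi v x <= 1.
  by rewrite pr_reach_ge0 ?pr_reach_le1 // => u; exact: D_planted_ge0.
pose y (v : bp_vertex B) := K^-1 * \sum_(a : ktuples n k) `|bias P (phi v) a|.
pose A := [set v | bp_layer (b := B) v == widen_ord (leqnSn m) j].
have y0 v : 0 <= y v by rewrite mulr_ge0 ?invr_ge0 // sumr_ge0.
pose mu (v : bp_vertex B) := \sum_(x : cube n) (2 ^+ n)^-1 * phi v x.
have w0 : 0 <= (2 ^+ n)^-1 :> R by rewrite invr_ge0 exprn_ge0.
(* The layer has at most [4 ^ p] vertices, reached with total probability at most 1 for each
   secret. *)
have hy : \sum_(v in A) y v <= 2 * T.
  apply: (sum_le_of_pow (p := p) (mu := mu)) => //.
  - apply: leq_trans wB; apply: (leq_trans _ (leq_bigmax (widen_ord (leqnSn m) j))).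
    by [].
  - by move=> v; apply: sumr_ge0 => x _; rewrite mulr_ge0 //; case/andP: (phi01 v x).
  - rewrite exchange_big /=; apply: (@le_trans _ _ (\sum_(x : cube n) (2 ^+ n)^-1)).
      apply: ler_sum => x _; rewrite -mulr_sumr ler_piMr //.
      apply: le_trans (@sum_pr_reach_le1 _ _ _ B _ j (@D_planted_ge0 x) (D1 x)).
      rewrite [leRHS](bigID (mem A)) /= lerDl; apply: sumr_ge0 => v _.
      by case/andP: (phi01 v x).
    by rewrite sum_cube_weight.
  - by move=> v; apply: sum_norm_bias_le Pt _ _ _ TE _ _.
apply: (@le_trans _ _ (\sum_(v in A) y v / 2)); last first.
  by rewrite -mulr_suml ler_pdivrMr // mulrC.
rewrite [leRHS]big_mkcond /=; apply: ler_sum => v _.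
case E: (bp_node v) => [o|f].
  (* At a leaf the continuation ignores the sample, and the planted and null masses agree, so the
     term vanishes. *)
  rewrite big1 => [|x _]; first by case: ifP => // _; rewrite divr_ge0.
  rewrite (eq_bigr (fun u => (D_planted R P x u - D_null R u)
    * pr_output (@D_null R n k) true (m - j.+1) v)) => [|u _]; last first.
    by rewrite /bp_step E.
  by rewrite -mulr_suml sumrB sum_D_planted sum_D_null subrr mul0r !mulr0.
case: ifP => vA.
  apply: step_bias_le => u; have D0 := D_null_ge0.
  rewrite pr_output_ge0 //=.
  have := pr_output_total (m - j.+1) (bp_step v u) D0.
  rewrite sum_D_null => /(_ divff_le1); apply: le_trans.
  by rewrite lerDr pr_output_ge0.
rewrite big1 // => x _; have [->|nz] := eqVneq (pr_reach (D_planted R P x) j v) 0.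
  by rewrite mul0r mulr0.
have := pr_reach_layer E nz => hj; move: vA; rewrite inE => /eqP []; exact: val_inj.
Qed.

(** Under [D_null] the two outputs have total probability at most 1, so success exceeds 1/2 by at
    most half of the advantage. *)
Lemma success_le (m p t : nat) (B : branching_program (sample n k) m) (T : R) :
  vanishes_below R P t -> (0 < n)%N -> (0 < p)%N -> 0 <= T ->
  T ^+ 2 = (k%:R * p.*2.-1%:R / n%:R) ^+ t ->
  k%:R * p.*2.-1%:R / n%:R <= 1 :> R ->
  (bp_width B <= 4 ^ p)%N ->
  success R P B <= 1 / 2 + m%:R * T / 2.
Proof.
move=> Pt n0 p0 T0 TE r1 wB; have := advantage_le Pt n0 p0 T0 TE r1 wB.
under eq_bigr do rewrite mulrBr.
rewrite sumrB -mulr_sumr -mulr_suml sum_cube_weight mul1r.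
have := pr_output_total m (bp_start B) D_null_ge0.
rewrite sum_D_null => /(_ divff_le1).
rewrite -pr_outputE => h0; under eq_bigr do rewrite -pr_outputE.
by rewrite /success; move: h0; rewrite /bp_output => h0 h1; lra.
Qed.

End Advantage.

(** * Choice of parameters *)

Lemma ln_nat_gt0 (R : realType) (q : nat) : (1 < q)%N -> 0 < ln q%:R :> R.
Proof. by move=> q1; rewrite ln_gt0 // ltr1n. Qed.

Lemma le_exp4_of_log2 (R : realType) (w p : nat) :
  log2 w%:R < p%:R :> R -> (w <= 4 ^ p)%N.
Proof.
have [->//|w0] := posnP w; have l2 := @ln_nat_gt0 R 2 isT.
rewrite /log2 ltr_pdivrMr // mulr_natl -lnXn ?ltr0n // ltr_ln ?posrE ?ltr0n ?exprn_gt0 //.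
rewrite -natrX ltr_nat => /ltnW/leq_trans; apply.
by case: p => [|p] //; rewrite leq_exp2r.
Qed.

(** The hypothesis on [eps] says [24 ^ 3 < n ^ (1 - eps)]; this is its cube root. *)
Lemma root_gt1 (R : realType) (n : nat) (eps : R) : (1 < n)%N ->
  eps < 1 - 3 * (log2 24 / log2 n%:R) ->
  24 < (n%:R `^ ((1 - eps) / 36)) ^+ 12.
Proof.
move=> n1; have l2 := @ln_nat_gt0 R 2 isT; have ln0 := ln_nat_gt0 R n1.
have -> : log2 24 / log2 n%:R = ln 24 / ln n%:R :> R.
  by rewrite /log2; field; rewrite !gt_eqF.
move=> h; have h3 : 3 * ln 24 < (1 - eps) * ln n%:R.
  by rewrite -ltr_pdivrMr // -mulrA; lra.
rewrite -powR_mulrn ?powR_ge0 // -powRrM /powR gt_eqF ?ltr0n 1?ltnW //.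
rewrite -[X in X < _]lnK ?posrE ?ltr0n // ltr_expR; lra.
Qed.

Theorem theorem5p1 (R : realType) :
  exists c c1 : R, [/\ 0 < c, 0 < c1 &
    forall (n k t : nat) (P : cube k -> bool) (eps s : R)
      (m : nat) (B : branching_program (sample n k) m),
      resilient R P t ->
      0 < eps ->
      eps < 1 - 3 * (log2 24 / log2 n%:R) ->
      k%:R < n%:R / c ->
      success R P B >= 1 / 2 + s ->
      bp_memory R B < n%:R `^ eps ->
      (0 < t <= k)%N ->
      k%:R < n%:R `^ ((1 - eps) / 6) / 3 ->
      s > c1 * (n%:R / t%:R) `^ (- ((1 - eps) / 36 * t%:R)) ->
      m%:R >= (n%:R / t%:R) `^ ((1 - eps) / 36 * t%:R)].
Proof.
(* Both constants can be 1: [c] yields [k < n], and [c1] makes [s] exceed the inverse of the claimed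
   sample bound. *)
exists 1, 1; split=> // n k t P eps s m B [t0 Pt _] eps0 hN kn hs hmem /andP[_ tk] hk hs1.
rewrite divr1 ltr_nat in kn.
have n1 : (1 < n)%N by apply: leq_ltn_trans kn; apply: leq_trans tk.
have n0 : (0 < n)%N by apply: ltnW.
have nR : 1 <= n%:R :> R by rewrite ler1n.
have nR0 : 0 < n%:R :> R by rewrite ltr0n.
(* Sizes are measured in powers of [z]: [k < z ^+ 6 / 3] and [n = n ^ eps * z ^+ 36]. *)
set del := (1 - eps) / 36 in hs1 *; set z := n%:R `^ del.
have z24 : 24 < z ^+ 12 by apply: root_gt1.
have z0 : 0 < z by rewrite /z powR_gt0.
have z1 : 1 < z.
  by rewrite -(@ltr_pXn2r _ 12) ?nnegrE ?ltW // expr1n; lra.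
have del0 : 0 < del.
  rewrite ltNge; apply/negP => d0; move: z1; rewrite ltNge => /negP; apply.
  by rewrite -[leRHS](powRr0 n%:R); apply: ler_powR.
have zk : k%:R < z ^+ 6 / 3.
  by move: hk; rewrite /z -powR_mulrn ?powR_ge0 // -powRrM /del; congr (_ < _ `^ _ / _); field.
(* The integer just above [n ^ eps]: it exceeds the memory and is at most [2 * n ^ eps]. *)
pose p := (Num.truncn (n%:R `^ eps)).+1.
have e1 : 1 <= n%:R `^ eps by rewrite -[leLHS](powRr0 n%:R); apply: ler_powR => //; apply: ltW.
have ep : n%:R `^ eps < p%:R by exact: truncnS_gt.
have pe : p%:R <= 2 * n%:R `^ eps.
  have := truncn_le (n%:R `^ eps); rewrite powR_ge0 /p -natr1; lra.
have wB : (bp_width B <= 4 ^ p)%N.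
  by apply: (@le_exp4_of_log2 R); apply: lt_trans hmem ep.
have ez : n%:R = n%:R `^ eps * z ^+ 36.
  rewrite /z -powR_mulrn ?powR_ge0 // -powRrM -powRD; last by rewrite (gt_eqF nR0) implybT.
  by rewrite /del -[LHS]powRr1 ?ler0n //; congr (_ `^ _); field.
pose r : R := k%:R * p.*2.-1%:R / n%:R.
have r0 : 0 <= r by rewrite /r divr_ge0 // mulr_ge0.
have rz : r * z ^+ 30 <= 4 / 3.
  have q4 : p.*2.-1%:R <= 4 * n%:R `^ eps.
    apply: (@le_trans _ _ (p.*2)%:R); first by rewrite ler_nat leq_pred.
    by rewrite -mul2n natrM; lra.
  rewrite /r mulrAC ler_pdivrMr // [in leRHS]ez.
  apply: (@le_trans _ _ (z ^+ 6 / 3 * (4 * n%:R `^ eps) * z ^+ 30)).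
    by apply: (ler_wpM2r (exprn_ge0 _ (ltW z0))); apply: ler_pM => //; apply: ltW.
  by rewrite le_eqVlt; apply/orP; left; apply/eqP; ring.
(* The end of the proof needs four powers of [z], to dominate [Q ^+ 4]; the other 26 absorb the
   constant 4/3. *)
have r26 : z ^+ 4 * r <= 1.
  have z26 : 2 <= z ^+ 26.
    have -> : z ^+ 26 = z ^+ 12 * z ^+ 14 by rewrite -exprD.
    have : 1 <= z ^+ 14 by rewrite exprn_ege1 ?ltW.
    by move: z24; nra.
  have : z ^+ 4 * r * z ^+ 26 <= 4 / 3 by rewrite mulrAC -exprD mulrC.
  have : 0 <= z ^+ 4 * r by rewrite mulr_ge0 ?(exprn_ge0 _ (ltW z0)).
  move: (z ^+ 4 * r) (z ^+ 26) z26 => u v; nra.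
have r1 : r <= 1.
  by apply: le_trans r26; rewrite ler_peMl // exprn_ege1 ?ltW.
pose T := Num.sqrt (r ^+ t).
have TE : T ^+ 2 = r ^+ t by rewrite sqr_sqrtr ?exprn_ge0.
have T0 : 0 <= T by rewrite sqrtr_ge0.
have := success_le Pt n0 (isT : 0 < p)%N T0 TE r1 wB => hT.
set Q := _ `^ (del * t%:R).
have Q0 : 0 < Q by rewrite /Q powR_gt0 // divr_gt0 ?ltr0n.
have Qz : Q <= z ^+ t.
  rewrite -powR_mulrn ?powR_ge0 // -powRrM; apply: ge0_ler_powR.
  - by rewrite mulr_ge0 ?(ltW del0).
  - by rewrite nnegrE divr_ge0.
  - by rewrite nnegrE.
  - by rewrite ler_pdivrMr ?ltr0n // ler_peMr ?ler0n // ler1n.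
(* If [m < Q], then [1 / Q < s <= Q * T / 2], so [Q ^+ 2 * T > 2]; but [Q ^+ 4 * T ^+ 2 <= (z ^+ 4 *
   r) ^+ t <= 1]. *)
rewrite leNgt; apply/negP => mQ.
have sQ : 1 < s * Q by rewrite -ltr_pdivrMr // mul1r; move: hs1; rewrite powRN mul1r.
have sT : s <= Q * T / 2.
  have : m%:R * T <= Q * T by rewrite ler_wpM2r // ltW.
  by move: hs hT; lra.
have QT : 2 < Q ^+ 2 * T by move: sQ sT Q0; nra.
have : (Q ^+ 2 * T) ^+ 2 <= 1.
  rewrite exprMn -exprM TE; apply: (@le_trans _ _ ((z ^+ 4 * r) ^+ t)).
    rewrite [(z ^+ 4 * r) ^+ t]exprMn ler_wpM2r ?(exprn_ge0 _ r0) //.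
    rewrite -[leRHS]exprM [(4 * t)%N]mulnC [leRHS]exprM.
    apply: lerXn2r => //; rewrite nnegrE ?(exprn_ge0 _ (ltW z0)) ?(ltW Q0) //.
  by rewrite exprn_ile1 // mulr_ge0 ?(exprn_ge0 _ (ltW z0)).
by move: QT; nra.
Qed.
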